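(* Let $A$ be an integral domain. Any inductive limit of PS modules over $A$ is a PS module over $A$.
   Context: All rings are commutative and unitary. For an integral domain $A$, a torsion-free $A$-module $M$ is a PS module (pre-Schreier module) if every equality $ax=by$ with $a,b\in A-\{0\}$ and $x,y\in M-\{0\}$ has a refinement, i.e. there exist $c,d,e\in A$ and $z\in M$ with $a=ce$, $b=cd$, $x=dz$, $y=ez$. ''Inductive limit'' means the direct limit of an inductive system $\{f_{ij}:M_i\to M_j \mid i\le j,\ i,j\in I\}$ of $A$-modules and $A$-linear maps indexed by a directed set $I$. *)

(* Defs.v *)
From HB Require Import structures.
From mathcomp Require Import all_boot all_order all_algebra.

Set Implicit Arguments.
Unset Strict Implicit.
Unset Printing Implicit Defensive.

Import Order.TTheory GRing.Theory.

Local Open Scope ring_scope.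

Definition torsion_free (A : idomainType) (M : lmodType A) : Prop :=
  forall (a : A) (x : M), a *: x = 0 -> a = 0 \/ x = 0.

Definition PS_module (A : idomainType) (M : lmodType A) : Prop :=
  torsion_free M /\
  forall (a b : A) (x y : M), a <> 0 -> b <> 0 -> x <> 0 -> y <> 0 ->
    a *: x = b *: y ->
    exists (c d e : A) (z : M),
      [/\ a = c * e, b = c * d, x = d *: z & y = e *: z].

Definition directed_set (disp : Order.disp_t) (I : preorderType disp) : Prop :=
  (exists i : I, True) /\
  forall i j : I, exists k : I, (i <= k)%O /\ (j <= k)%O.

(* The order on [I] is boolean, so the proofs of [(i <= j)%O] on which the
   transition maps depend are unique. *)
Record inductive_system (A : idomainType) (disp : Order.disp_t)
    (I : preorderType disp) := InductiveSystem {
  ind_mod :> I -> lmodType A;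
  ind_map : forall i j : I, (i <= j)%O -> {linear ind_mod i -> ind_mod j};
  ind_map_id : forall (i : I) (hii : (i <= i)%O) (x : ind_mod i),
    ind_map hii x = x;
  ind_map_comp : forall (i j k : I)
      (hij : (i <= j)%O) (hjk : (j <= k)%O) (hik : (i <= k)%O) (x : ind_mod i),
    ind_map hjk (ind_map hij x) = ind_map hik x
}.

Definition is_cocone (A : idomainType) (disp : Order.disp_t)
    (I : preorderType disp) (S : inductive_system A I) (L : lmodType A)
    (phi : forall i : I, {linear S i -> L}) : Prop :=
  forall (i j : I) (hij : (i <= j)%O) (x : S i),
    phi j (ind_map S hij x) = phi i x.

Definition is_inductive_limit (A : idomainType) (disp : Order.disp_t)
    (I : preorderType disp) (S : inductive_system A I) (L : lmodType A)
    (phi : forall i : I, {linear S i -> L}) : Prop :=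
  is_cocone phi /\
  forall (N : lmodType A) (psi : forall i : I, {linear S i -> N}),
    is_cocone psi ->
    exists u : {linear L -> N},
      (forall (i : I) (x : S i), u (phi i x) = psi i x) /\
      (forall v : {linear L -> N},
         (forall (i : I) (x : S i), v (phi i x) = psi i x) -> v =1 u).

(* Main.v *)
Require Import Defs.
From HB Require Import structures.
From mathcomp Require Import all_boot all_order all_algebra.
From mathcomp Require Import boolp.

(** Both facts about a directed limit [L] that the proof needs are extracted
    from its universal property. The images of the [S i] exhaust [L], because
    their union is a submodule through which the identity of [L] factors. An
    element of [S i] that vanishes in [L] already vanishes in some [S j],
    because the families [(x_j)_j] modulo the eventually zero ones form a module
    to which the system maps. A relation [a x = b y] in [L] therefore comes from
    a relation in a single [S l], and its refinement there is pushed to [L]. *)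

Set Implicit Arguments.
Unset Strict Implicit.
Unset Printing Implicit Defensive.

Import Order.TTheory GRing.Theory.

Local Open Scope ring_scope.
Local Open Scope quotient_scope.

(** * Products of arbitrary families of modules *)

Section DirectProduct.
Variables (A : pzRingType) (I : Type) (M : I -> lmodType A).

Definition dirprod := forall i, M i.

(** The index type is arbitrary, so equality tests and choice on families are classical. *)
HB.instance Definition _ := gen_eqMixin dirprod.
HB.instance Definition _ := gen_choiceMixin dirprod.

Implicit Types f g h : dirprod.

Definition dirprod_add f g : dirprod := fun i => f i + g i.
Definition dirprod_opp f : dirprod := fun i => - f i.
Definition dirprod_zero : dirprod := fun=> 0.
Definition dirprod_scale (a : A) f : dirprod := fun i => a *: f i.

Fact dirprod_addA : associative dirprod_add.
Proof. by move=> f g h; apply/functional_extensionality_dep => i; exact: addrA. Qed.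

Fact dirprod_addC : commutative dirprod_add.
Proof. by move=> f g; apply/functional_extensionality_dep => i; exact: addrC. Qed.

Fact dirprod_add0 : left_id dirprod_zero dirprod_add.
Proof. by move=> f; apply/functional_extensionality_dep => i; exact: add0r. Qed.

Fact dirprod_addN : left_inverse dirprod_zero dirprod_opp dirprod_add.
Proof. by move=> f; apply/functional_extensionality_dep => i; exact: addNr. Qed.

HB.instance Definition _ :=
  GRing.isZmodule.Build dirprod dirprod_addA dirprod_addC dirprod_add0 dirprod_addN.

Fact dirprod_scaleA a b f : dirprod_scale a (dirprod_scale b f) = dirprod_scale (a * b) f.
Proof. by apply/functional_extensionality_dep => i; exact: scalerA. Qed.

Fact dirprod_scale1 : left_id 1 dirprod_scale.
Proof. by move=> f; apply/functional_extensionality_dep => i; exact: scale1r. Qed.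

Fact dirprod_scaleDr : right_distributive dirprod_scale +%R.
Proof. by move=> a f g; apply/functional_extensionality_dep => i; exact: scalerDr. Qed.

Fact dirprod_scaleDl f : {morph dirprod_scale^~ f : a b / a + b}.
Proof. by move=> a b; apply/functional_extensionality_dep => i; exact: scalerDl. Qed.

HB.instance Definition _ := GRing.Zmodule_isLmodule.Build A dirprod
  dirprod_scaleA dirprod_scale1 dirprod_scaleDr dirprod_scaleDl.

End DirectProduct.

(** * Submodules and quotients by submodules *)

Section SubQuotientModule.
Variables (A : pzRingType) (M : lmodType A) (S : {pred M}).
Hypothesis Smod : submod_closed S.

(* [S] carrying the proof of its closure, so that this proof can be found by
   canonical structure inference. *)
Definition submod_pred of submod_closed S := S.
Local Notation W := (submod_pred Smod).

HB.instance Definition _ := GRing.isSubmodClosed.Build A M W Smod.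

Definition submodule := {x : M | x \in W}.

HB.instance Definition _ := SubChoice.on submodule.
HB.instance Definition _ := [SubChoice_isSubLmodule of submodule by <:].

Definition modquot := Quotient.quot W.

HB.instance Definition _ := GRing.Zmodule.on modquot.

Definition modproj (x : M) : modquot := \pi_(Quotient.quot W) x.

Fact modproj_is_zmod_morphism : zmod_morphism modproj.
Proof. exact: raddfB. Qed.

HB.instance Definition _ :=
  GRing.isZmodMorphism.Build M modquot modproj modproj_is_zmod_morphism.

Lemma modproj_eq x y : (modproj x == modproj y) = (x - y \in W).
Proof. by rewrite Quotient.idealrBE. Qed.

Definition modquot_scale (a : A) (q : modquot) : modquot :=
  modproj (a *: repr (q : Quotient.quot W)).

(** Representatives of one class differ by an element of [W], which is stable under scaling, so the
    choice made by [repr] is harmless. The module laws then descend from [M]. *)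
Lemma modproj_scale a x : modproj (a *: x) = modquot_scale a (modproj x).
Proof.
apply/eqP; rewrite modproj_eq -scalerBr rpredZ // -modproj_eq.
by rewrite /modproj reprK.
Qed.

Lemma modprojP (q : modquot) : exists x, q = modproj x.
Proof. by exists (repr (q : Quotient.quot W)); rewrite /modproj reprK. Qed.

Fact modquot_scaleA a b q :
  modquot_scale a (modquot_scale b q) = modquot_scale (a * b) q.
Proof. by have [x ->] := modprojP q; rewrite -!modproj_scale scalerA. Qed.

Fact modquot_scale1 : left_id 1 modquot_scale.
Proof. by move=> q; have [x ->] := modprojP q; rewrite -modproj_scale scale1r. Qed.

Fact modquot_scaleDr : right_distributive modquot_scale +%R.
Proof.
move=> a p q; have [x ->] := modprojP p; have [y ->] := modprojP q.
by rewrite -raddfD -!modproj_scale scalerDr raddfD.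
Qed.

Fact modquot_scaleDl q : {morph modquot_scale^~ q : a b / a + b}.
Proof.
move=> a b; have [x ->] := modprojP q.
by rewrite -!modproj_scale scalerDl raddfD.
Qed.

HB.instance Definition _ := GRing.Zmodule_isLmodule.Build A modquot
  modquot_scaleA modquot_scale1 modquot_scaleDr modquot_scaleDl.

Fact modproj_is_scalable : scalable modproj.
Proof. exact: modproj_scale. Qed.

HB.instance Definition _ :=
  GRing.isScalable.Build A M modquot *:%R modproj modproj_is_scalable.

End SubQuotientModule.

(** * Generation and vanishing in a directed limit *)

Section DirectedSystem.
Variables (A : idomainType) (disp : Order.disp_t) (I : preorderType disp).
Variable S : inductive_system A I.
Hypothesis dirI : directed_set I.

Definition eventually_zero : {pred dirprod S} :=
  fun f => `[< exists k : I, forall j, (k <= j)%O -> f j = 0 >].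

Lemma eventually_zeroP (f : dirprod S) :
  reflect (exists k : I, forall j, (k <= j)%O -> f j = 0) (f \in eventually_zero).
Proof. exact: asboolP. Qed.

Fact eventually_zero_submod_closed : submod_closed eventually_zero.
Proof.
split; first by have [[i _] _] := dirI; apply/eventually_zeroP; exists i.
move=> a f g /eventually_zeroP[k f0] /eventually_zeroP[l g0].
have [m [km lm]] := dirI.2 k l.
apply/eventually_zeroP; exists m => j mj.
have -> : (a *: f + g) j = a *: f j + g j by [].
by rewrite f0 ?(le_trans km)// g0 ?(le_trans lm)// scaler0 addr0.
Qed.

(** The reduced product of the [S i] along the filter generated by the tails of [I]. *)
Definition germ := modquot eventually_zero_submod_closed.

(* The components at the indices not above [i] are set to [0]; they do not matter
   modulo [eventually_zero]. *)
Definition trajectory (i : I) (x : S i) : dirprod S := fun j =>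
  match @idP (i <= j)%O with
  | ReflectT hij => ind_map S hij x
  | ReflectF _ => 0
  end.

Lemma trajectoryE i j (hij : (i <= j)%O) (x : S i) :
  trajectory x j = ind_map S hij x.
Proof.
rewrite /trajectory; case: {-}_ / idP => // h.
by rewrite (bool_irrelevance h hij).
Qed.

Fact trajectory_is_linear i : linear (@trajectory i).
Proof.
move=> a x y; apply/functional_extensionality_dep => j.
have -> : (a *: trajectory x + trajectory y) j =
  a *: trajectory x j + trajectory y j by [].
rewrite /trajectory; case: {-}_ / idP => h; first by rewrite linearP.
by rewrite scaler0 addr0.
Qed.

HB.instance Definition _ i := GRing.isLinear.Build A (S i) (dirprod S) *:%R
  (@trajectory i) (@trajectory_is_linear i).

Definition to_germ (i : I) : {linear S i -> germ} :=
  @modproj _ _ _ eventually_zero_submod_closed \o @trajectory i.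

(** The trajectories of [x] and of its image in [S j] agree from [j] onwards. *)
Lemma to_germ_cocone : is_cocone to_germ.
Proof.
move=> i j hij x; apply/eqP; rewrite modproj_eq.
apply/eventually_zeroP; exists j => k jk.
have ik := le_trans hij jk.
have -> : (trajectory (ind_map S hij x) - trajectory x) k =
  trajectory (ind_map S hij x) k - trajectory x k by [].
by rewrite (trajectoryE jk) (trajectoryE ik) (ind_map_comp hij jk ik) subrr.
Qed.

Lemma to_germ_eq0 i (x : S i) :
  to_germ i x = 0 -> exists (j : I) (hij : (i <= j)%O), ind_map S hij x = 0.
Proof.
rewrite -(raddf0 (@modproj _ _ _ eventually_zero_submod_closed)) => /eqP.
rewrite modproj_eq subr0 => /eventually_zeroP[k x0].
(* The threshold [k] need not lie above [i], and a trajectory is given by a transition map only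
   above [i]. *)
have [j [ij kj]] := dirI.2 i k.
by exists j, ij; rewrite -trajectoryE x0.
Qed.

Variables (L : lmodType A) (phi : forall i, {linear S i -> L}).

(** By the universal property [to_germ i] factors through [phi i], so it kills whatever [phi i]
    kills. *)
Lemma limit_eq0 i (x : S i) : is_inductive_limit phi ->
  phi i x = 0 -> exists (j : I) (hij : (i <= j)%O), ind_map S hij x = 0.
Proof.
move=> [_ /(_ _ _ to_germ_cocone)[u [uphi _]]] x0.
by apply: to_germ_eq0; rewrite -uphi x0 raddf0.
Qed.

Definition cocone_image : {pred L} := fun l => `[< exists i x, phi i x = l >].

Lemma cocone_imageP l : reflect (exists i x, phi i x = l) (l \in cocone_image).
Proof. exact: asboolP. Qed.

Lemma cocone_common i j (x : S i) (y : S j) : is_cocone phi ->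
  exists k (x' y' : S k), phi k x' = phi i x /\ phi k y' = phi j y.
Proof.
move=> cphi; have [k [ik jk]] := dirI.2 i j.
by exists k, (ind_map S ik x), (ind_map S jk y); rewrite !cphi.
Qed.

Lemma cocone_image_submod_closed : is_cocone phi -> submod_closed cocone_image.
Proof.
move=> cphi; split.
  by have [[i _] _] := dirI; apply/cocone_imageP; exists i, 0; rewrite raddf0.
move=> a _ _ /cocone_imageP[i [x <-]] /cocone_imageP[j [y <-]].
have [k [x' [y' [<- <-]]]] := cocone_common x y cphi.
by apply/cocone_imageP; exists k, (a *: x' + y'); rewrite linearP.
Qed.

Lemma limit_surj l : is_inductive_limit phi -> exists i x, phi i x = l.
Proof.
move=> [cphi univ]; have cl := cocone_image_submod_closed cphi.
have imP i x : phi i x \in submod_pred cl by apply/cocone_imageP; exists i, x.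
(* The corestriction of [phi i] to the union of the images. *)
pose psi0 i x : submodule cl := Sub (phi i x) (imP i x).
have psi0_lin i : linear (psi0 i).
  by move=> a x y; apply: val_inj; rewrite linearP /= linearP.
pose psi i : {linear S i -> submodule cl} :=
  HB.pack (psi0 i) (GRing.isLinear.Build A (S i) (submodule cl) *:%R _ (psi0_lin i)).
have cpsi : is_cocone psi.
  by move=> i j hij x; apply: val_inj; rewrite !SubK cphi.
have [u [uphi _]] := univ _ _ cpsi.
(* [v] is the only endomorphism of [L] compatible with [phi]. Both [val \o u] and the identity are
   compatible, so they coincide and every [l] lies in the image. *)
have [v [_ vuniq]] := univ _ _ cphi.
have /cocone_imageP := valP (u l).
suff -> : val (u l) = l by [].
have vul : val (u l) = v l.
  by apply: (vuniq (val \o u)) => i x /=; rewrite uphi SubK.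
by rewrite vul -(vuniq idfun).
Qed.

Lemma limit_eq i (x y : S i) : is_inductive_limit phi -> phi i x = phi i y ->
  exists (j : I) (hij : (i <= j)%O), ind_map S hij x = ind_map S hij y.
Proof.
move=> lim /eqP; rewrite -subr_eq0 -raddfB => /eqP /(limit_eq0 lim)[j [hij]].
by rewrite raddfB => /subr0_eq xy; exists j, hij.
Qed.

(** The relation [a *: l = 0] already holds at some stage [j], for a representative of [l] in
    [S j]. *)
Lemma limit_torsion_free : is_inductive_limit phi ->
  (forall i, torsion_free (S i)) -> torsion_free L.
Proof.
move=> lim tfS a l; have [i [x <-]] := limit_surj l lim.
rewrite -linearZ => /(limit_eq0 lim)[j [hij]].
rewrite linearZ => /tfS[->|x0]; [by left|right].
by rewrite -(lim.1 _ _ hij) x0 raddf0.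
Qed.

Lemma limit_lift_pair l m : is_inductive_limit phi ->
  exists i (x y : S i), phi i x = l /\ phi i y = m.
Proof.
move=> lim; have [i [x <-]] := limit_surj l lim.
by have [j [y <-]] := limit_surj m lim; apply: cocone_common lim.1.
Qed.

End DirectedSystem.

Theorem proposition4p1 (A : idomainType) (disp : Order.disp_t)
    (I : preorderType disp) (S : inductive_system A I) (L : lmodType A)
    (phi : forall i : I, {linear S i -> L}) :
  directed_set I ->
  (forall i : I, PS_module (S i)) ->
  is_inductive_limit phi ->
  PS_module L.
Proof.
move=> dirI PS lim; split.
  by apply: (limit_torsion_free dirI lim) => i; have [] := PS i.
move=> a b l m a0 b0.
have [i [x [y [<- <-]]]] := limit_lift_pair dirI l m lim.
move=> x0 y0; rewrite -!linearZ => /(limit_eq dirI lim)[j [hij]].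
rewrite !linearZ => axby.
(* Refinements exist only for nonzero elements. Since [phi i] factors through [S j], an element that
   dies in [S j] would die in [L]. *)
have nz z : phi i z <> 0 -> ind_map S hij z <> 0.
  by move=> z0 e; apply: z0; rewrite -(lim.1 _ _ hij) e raddf0.
have [c [d [e [z [ae bd xd ye]]]]] :=
  (PS j).2 _ _ _ _ a0 b0 (nz _ x0) (nz _ y0) axby.
(* The scalars found over [S j] are kept; only the vector moves to [L]. *)
exists c, d, e, (phi j z); split => //.
  by rewrite -(lim.1 _ _ hij) xd linearZ.
by rewrite -(lim.1 _ _ hij) ye linearZ.
Qed.
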